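(* Let $\mathcal{P}\subset\mathbb{R}^n$ be the boundary of a convex polytope, and let $S\subset\mathbb{R}^n$. If $B\subset\mathbb{R}^n$ contains a homothetic copy of $\mathcal{P}$ centered at each point of $S$, then \[\dim_P B\ge n-1+\frac{1}{n+1}\dim_P S.\]
   Context: A homothetic copy of $\mathcal{P}$ centered at $x$ is a set $x+r\mathcal{P}$ with $r>0$, where $\mathcal{P}$ is regarded as centered at the origin. $\dim_P$ denotes packing dimension. *)

(* Defs.v *)
From HB Require Import structures.
From mathcomp Require Import all_boot all_order all_algebra.
From mathcomp Require Import all_classical all_reals all_analysis.

Set Implicit Arguments.
Unset Strict Implicit.
Unset Printing Implicit Defensive.

Import Order.TTheory GRing.Theory Num.Theory.
Import numFieldNormedType.Exports.

Local Open Scope classical_set_scope.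
Local Open Scope ring_scope.

Section Defs.
Context {R : realType} {n : nat}.
Implicit Types (A K : set 'rV[R]_n) (d : R).

Definition convex_hull_of m (v : 'I_m -> 'rV[R]_n) : set 'rV[R]_n :=
  [set x | exists w : 'I_m -> R,
    [/\ forall i, 0 <= w i, \sum_i w i = 1 & x = \sum_i w i *: v i]].

(* Polytopes of R^n are full-dimensional: nonempty interior is what makes the
   topological boundary the union of the (n-1)-dimensional facets. *)
Definition convex_polytope K : Prop :=
  (exists m (v : 'I_m -> 'rV[R]_n), K = convex_hull_of v) /\ K° !=set0.

Definition boundary A : set 'rV[R]_n := closure A `\` A°.

Definition homothetic_copy (x : 'rV[R]_n) (r : R) A : set 'rV[R]_n :=
  [set x + r *: p | p in A].

(* The library norm on 'rV[R]_n is the max norm, hence the explicit formula. *)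
Definition euclidean_cball (c : 'rV[R]_n) d : set 'rV[R]_n :=
  [set x | Num.sqrt (\sum_i (x 0 i - c 0 i) ^+ 2) <= d].

(* Least number of closed Euclidean d-balls covering A; +oo if there is no
   finite cover. *)
Definition covering_number A d : \bar R :=
  ereal_inf [set k%:R%:E | k in [set k : nat |
    exists c : 'I_k -> 'rV[R]_n,
      A `<=` \bigcup_i euclidean_cball (c i) d]].

(* limsup_{d -> 0+} log N(A, d) / log (1/d), with log 0 = -oo, so that the
   empty set has dimension -oo. *)
Definition upper_box_dim A : \bar R :=
  limf_esup (fun d => lne (covering_number A d) / (ln d^-1)%:E)%E 0^'+.

(* Packing dimension as the countably stable modification of the upper box
   (Minkowski) dimension, as in Mattila's Geometry of Sets and Measures in
   Euclidean Spaces, section 5.9. *)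
Definition packing_dim A : \bar R :=
  ereal_inf [set ereal_sup (range (fun i => upper_box_dim (F i))) |
    F in [set F : nat -> set 'rV[R]_n |
      (forall i, bounded_set (F i)) /\ A `<=` \bigcup_i F i]].

End Defs.

(* Main.v *)
(** Write the homothetic copy of [P] of centre [x] and ratio [r] through its
    facet hyperplanes [dot (u i) y = dot (u i) x + r * h i]. Not all facet
    hyperplanes of a polytope pass through one point or are parallel to
    one direction, so [n + 1] of them determine [(x, r)], in a Lipschitz
    way. Let countably many bounded sets [F j] cover [B]. By Baire, every
    facet of every copy contains a flat disc inside the closure of some [F
    j], so [S] splits into countably many pieces on each of which the [n +
    1] indices [j] and the size of the discs are fixed. If such a piece
    needs [M] balls of radius [d], then one of the [n + 1] facet offsets
    takes about [M `^ (n + 1)^-1] values that are [d]-separated, and the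
    corresponding [F j] contains that many parallel discs, each needing
    about [d ^- (n - 1)] balls. *)

Require Import Defs.
From HB Require Import structures.
From mathcomp Require Import all_boot all_order all_algebra.
From mathcomp Require Import all_classical all_reals all_analysis.
From mathcomp Require Import lra ring.

Import Order.TTheory GRing.Theory Num.Theory.
Import numFieldNormedType.Exports.

Local Open Scope classical_set_scope.
Local Open Scope ring_scope.

(** * Linear forms and the max norm on row vectors *)

Lemma lipschitz_continuous (R : realType) (V W : normedModType R) (f : V -> W)
    (k : R) :
  (forall x y, `|f x - f y| <= k * `|x - y|) -> continuous f.
Proof.
move=> fk x; apply/cvgrPdist_lt => e e0.
near=> y; apply: (le_lt_trans (fk _ _)).
apply: (@le_lt_trans _ _ ((`|k| + 1) * `|x - y|)).
  by rewrite ler_wpM2r // (le_trans (ler_norm k)) // lerDl.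
rewrite mulrC -ltr_pdivlMr ?ltr_wpDl //.
by near: y; apply: cvgr_dist_lt => //; rewrite divr_gt0 // ltr_wpDl.
Unshelve. all: by end_near. Qed.

Section LinearForms.
Context {R : realType} {n : nat}.
Implicit Types (u x y z w : 'rV[R]_n) (a e t h : R).

Definition dot u x : R := \sum_i u 0 i * x 0 i.

Lemma dotDr u x y : dot u (x + y) = dot u x + dot u y.
Proof. by rewrite -big_split /=; apply: eq_bigr => i _; rewrite mxE mulrDr. Qed.

Lemma dotZr u a x : dot u (a *: x) = a * dot u x.
Proof. by rewrite mulr_sumr; apply: eq_bigr => i _; rewrite mxE mulrCA. Qed.

Lemma dotNr u x : dot u (- x) = - dot u x.
Proof. by rewrite -scaleN1r dotZr mulN1r. Qed.

Lemma dotBr u x y : dot u (x - y) = dot u x - dot u y.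
Proof. by rewrite dotDr dotNr. Qed.

Lemma dot_delta u k : dot u (delta_mx 0 k) = u 0 k.
Proof.
rewrite /dot (bigD1 k) //= mxE !eqxx mulr1 big1 ?addr0 // => i /negPf ik.
by rewrite mxE ik andbF mulr0.
Qed.

Lemma dot_sumr (I : finType) u (F : I -> 'rV[R]_n) :
  dot u (\sum_i F i) = \sum_i dot u (F i).
Proof.
rewrite /dot exchange_big /=; apply: eq_bigr => i _.
by rewrite summxE mulr_sumr.
Qed.

Lemma neq0_dot_eq1 u : u != 0 -> exists w, dot u w = 1.
Proof.
move=> u0; have [k uk] : exists k, u 0 k != 0.
  apply/existsP; rewrite -negb_forall; apply: contra u0 => /forallP u0.
  by apply/eqP/rowP => i; rewrite mxE; apply/eqP/u0.
exists ((u 0 k)^-1 *: delta_mx 0 k).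
by rewrite dotZr dot_delta mulVf.
Qed.

Lemma coord_le_norm x i : `|x 0 i| <= `|x|.
Proof.
rewrite [leRHS]/Num.Def.normr /= mx_normrE.
by apply/bigmax_geP; right => /=; exists (0, i).
Qed.

Lemma norm_le_coord x e : 0 <= e -> (forall i, `|x 0 i| <= e) -> `|x| <= e.
Proof.
move=> e0 xe; rewrite [leLHS]/Num.Def.normr /= mx_normrE.
by apply/bigmax_leP; split=> //= -[i j] _ /=; rewrite ord1.
Qed.

Lemma dot_le_norm u x : `|dot u x| <= (\sum_i `|u 0 i|) * `|x|.
Proof.
rewrite mulr_suml; apply: (le_trans (ler_norm_sum _ _ _)).
by apply: ler_sum => i _; rewrite normrM ler_wpM2l ?coord_le_norm.
Qed.

Lemma nbhs_norm x (A : set 'rV[R]_n) :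
  nbhs x A <-> exists2 e, 0 < e & forall y, `|y - x| < e -> A y.
Proof.
rewrite nbhs_ballP; split=> -[e e0 eA]; exists e => // y.
  by move=> xy; apply: eA; rewrite mx_norm_ball /ball_ /= distrC.
by rewrite mx_norm_ball /ball_ /= distrC; exact: eA.
Qed.

Lemma dot_continuous u : continuous (dot u : 'rV[R]_n -> R^o).
Proof.
apply: (@lipschitz_continuous _ 'rV[R]_n R^o _ (\sum_i `|u 0 i|)) => x y.
by rewrite -dotBr; exact: dot_le_norm.
Qed.

Lemma dist_continuous c : continuous (fun y : 'rV[R]_n => `|y - c| : R^o).
Proof.
apply: (@lipschitz_continuous _ 'rV[R]_n R^o _ 1) => y z; rewrite mul1r.
by apply: (le_trans (ler_dist_dist _ _)); rewrite opprB addrA subrK.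
Qed.

Lemma closed_norm_le c e : closed [set y : 'rV[R]_n | `|y - c| <= e].
Proof.
apply: (preimage_closed (f := fun y => `|y - c|) (D := [set t | t <= e])).
  by move=> y _; exact: dist_continuous.
exact: closed_le.
Qed.

Lemma interior_norm (A : set 'rV[R]_n) x :
  A° x <-> exists2 e, 0 < e & forall y, `|y - x| < e -> A y.
Proof. exact: nbhs_norm. Qed.

End LinearForms.

(** * Completeness of row vectors and Baire category on flat discs *)

HB.instance Definition _ (R : realType) n :=
  Uniform_isComplete.Build 'rV[R]_n cauchy_cvg.

Section Fat.
Context {R : realType} {n : nat}.
Implicit Types (u x y z w : 'rV[R]_n) (a e t h : R).

Definition flat_disc u c e : set 'rV[R]_n :=
  [set y | dot u y = dot u c /\ `|y - c| < e].

(* Baire category in [R^n] rather than in the hyperplane, by pulling the cover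
   back along the affine retraction [y |-> y - (dot u y - dot u c) *: w]. *)
Lemma flat_disc_baire u c e (F : nat -> set 'rV[R]_n) :
  u != 0 -> 0 < e -> flat_disc u c e `<=` \bigcup_j F j ->
  exists j c' e', [/\ 0 < e', dot u c' = dot u c &
    flat_disc u c' e' `<=` closure (F j)].
Proof.
move=> u0 e0 cF; have [w uw] := neq0_dot_eq1 _ u0.
pose rho y := y - (dot u y - dot u c) *: w.
have rho_cont : continuous rho.
  apply: (@lipschitz_continuous _ 'rV[R]_n 'rV[R]_n _
    (1 + (\sum_i `|u 0 i|) * `|w|)) => y z.
  have -> : rho y - rho z = (y - z) - dot u (y - z) *: w.
    by apply/rowP => i; rewrite /rho dotBr !mxE; ring.
  apply: (le_trans (ler_normB _ _)); rewrite mulrDl mul1r lerD2l normrZ mulrAC.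
  by rewrite ler_wpM2r // dot_le_norm.
have urho y : dot u (rho y) = dot u c by rewrite dotBr dotZr uw mulr1; ring.
have rhoc : rho c = c by rewrite /rho subrr scale0r subr0.
have : nbhs c (rho @^-1` [set y | `|y - c| < e]).
  by apply: rho_cont; rewrite rhoc; apply/nbhs_norm; exists e.
move=> /nbhs_norm[e1 e10 e1P].
pose A j := rho @^-1` (closure (F j)) `&` [set y | `|y - c| <= e1 / 2].
have clA j : closed (A j).
  apply: closedI.
    by apply: preimage_closed => [y _|]; [exact: rho_cont | exact: closed_closure].
  exact: closed_norm_le.
have [j Aj] : exists j, ~ dense (~` A j).
  apply: contrapT => /forallNP Ad.
  have AD j : open (~` A j) /\ dense (~` A j).
    by split; [rewrite openC; exact: clA | apply: contrapT => /Ad].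
  have := Baire AD (O := [set y | `|y - c| < e1 / 2]).
  case.
  - by exists c; rewrite /= subrr normr0 divr_gt0.
  - apply: (open_comp (f := fun y => `|y - c|) (D := [set t | t < e1 / 2])).
      by move=> y _; exact: dist_continuous.
    exact: open_lt.
  move=> y [/= yc yA].
  have [//|j _ Fj] := cF (rho y).
    split; first exact: urho.
    by apply: e1P; apply: (lt_trans yc); rewrite ltr_pdivrMr // ltr_pMr // ltr1n.
  by apply: (yA j I); split; [exact: subset_closure | exact: ltW].
have [U [U0 Uo UA]] : exists U, [/\ U !=set0, open U & U `<=` A j].
  apply: contrapT => /forallNP AU; apply: Aj => U U0 Uo.
  apply: contrapT => UA; apply: (AU U); split => // y Uy.
  by apply: contrapT => yA; apply: UA; exists y.
have [y0 Uy0] := U0.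
have /nbhs_norm[e2 e20 e2P] : nbhs y0 U by apply: open_nbhs_nbhs; split.
exists j, (rho y0), e2; split => // y [uy yr].
(* Translation by [y0 - rho y0], a multiple of [w], carries the disc into the ball around [y0]
   inside [U], and [rho] undoes this translation. *)
have -> : y = rho (y + (y0 - rho y0)).
  rewrite (_ : y0 - rho y0 = (dot u y0 - dot u c) *: w); last first.
    by rewrite /rho opprB addrC subrK.
  rewrite /rho dotDr uy urho dotZr uw mulr1 [_ + (_ - _)]addrC !subrK addrK.
  by [].
have [] // : A j (y + (y0 - rho y0)).
by apply: UA; apply: e2P; rewrite addrCA addrAC subrr add0r.
Qed.

End Fat.

(** * Convex hulls of finitely many points *)

Section ConvexHull.
Context {R : realType} {n m : nat}.
Variable v : 'I_m -> 'rV[R]_n.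
Implicit Types (u x y : 'rV[R]_n) (w : 'I_m -> R).

Lemma convex_hull_compact : compact (convex_hull_of v).
Proof.
pose D := [set w : 'rV[R]_m | (forall i, 0 <= w 0 i) /\ dot (const_mx 1) w = 1].
have dot1 (w : 'rV[R]_m) : dot (const_mx 1) w = \sum_i w 0 i.
  by apply: eq_bigr => i _; rewrite mxE mul1r.
pose f (w : 'rV[R]_m) := \sum_i w 0 i *: v i.
have -> : convex_hull_of v = f @` D.
  apply/seteqP; split=> [x [w [w0 w1 ->]]|_ [w [w0 w1] <-]].
    exists (\row_i w i); last by apply: eq_bigr => i _; rewrite mxE.
    split=> [i|]; first by rewrite mxE.
    by rewrite dot1 -w1; apply: eq_bigr => i _; rewrite mxE.
  by exists (fun i => w 0 i); split=> //; rewrite -dot1.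
apply: continuous_compact.
  apply: continuous_subspaceT.
  apply: (@lipschitz_continuous _ 'rV[R]_m 'rV[R]_n _ (\sum_i `|v i|)) => x y.
  rewrite /f -sumrB mulr_suml; apply: (le_trans (ler_norm_sum _ _ _)).
  apply: ler_sum => i _; rewrite -scalerBl normrZ mulrC ler_wpM2l //.
  by have := coord_le_norm (x - y) i; rewrite !mxE.
apply: bounded_closed_compact.
  exists 1; split; first exact: num_real.
  move=> M M1 w [w0 w1]; apply: norm_le_coord; first lra.
  move=> i; rewrite ger0_norm //; apply: (@le_trans _ _ 1); last lra.
  by rewrite -w1 dot1 (bigD1 i) //= lerDl sumr_ge0.
have -> : D = (\bigcap_i (dot (delta_mx 0 i) @^-1` [set t | 0 <= t]))
    `&` (dot (const_mx 1) @^-1` [set 1]).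
  have dotd i (w : 'rV[R]_m) : dot (delta_mx 0 i) w = w 0 i.
    by rewrite -(dot_delta w i); apply: eq_bigr => j _; rewrite mulrC.
  apply/seteqP; split=> w [w0 w1]; split => // i; first by rewrite /= dotd.
  by have := w0 i I; rewrite /= dotd.
apply: closedI.
  apply: closed_bigI => i _.
  apply: preimage_closed => [y _|]; [exact: dot_continuous | exact: closed_ge].
apply: preimage_closed => [y _|]; [exact: dot_continuous | exact: closed_eq].
Qed.

Lemma not_row_full_dot (D : 'M[R]_(m, n)) :
  ~~ row_full D -> exists2 u, u != 0 & forall i, dot u (row i D) = 0.
Proof.
rewrite /row_full -mxrank_tr -/(row_free D^T) -kermx_eq0.
move=> /rowV0Pn[u /sub_kermxP uD u0]; exists u => // i.
have := congr1 (fun M : 'rV_m => M 0 i) uD; rewrite !mxE => uD0.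
by rewrite -[RHS]uD0; apply: eq_bigr => j _; rewrite !mxE.
Qed.

(* The weights that are positive at [x] leave room to move [x] in every
   direction of the span of the corresponding [v i - x]. *)
Lemma convex_hull_interior w :
  (forall i, 0 <= w i) -> \sum_i w i = 1 ->
  let x := \sum_i w i *: v i in
  (forall u, u != 0 -> exists2 i, 0 < w i & dot u (v i) != dot u x) ->
  (convex_hull_of v)° x.
Proof.
move=> w0 w1 x ux.
pose D := \matrix_(i < m) (if 0 < w i then v i - x else 0).
have Dfull : row_full D.
  apply: contrapT => /negP/not_row_full_dot[u u0 uD].
  have [i wi /negP[]] := ux u u0.
  by have := uD i; rewrite rowK wi dotBr => /eqP; rewrite subr_eq0.
pose M := pinvmx D.
pose C := \sum_i \sum_k `|M k i|.
(* At most half of each positive weight and at most [1 / (2 * m)]. A vanishing weight contributes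
   [2 / 0 = 0] to the sum. *)
pose eta := (\sum_i 2 / w i + (2 * m%:R + 1))^-1.
have m0 : 0 <= m%:R :> R by [].
have S0 : 0 <= \sum_i 2 / w i by apply: sumr_ge0 => i _; rewrite divr_ge0.
have eta0 : 0 < eta.
  by rewrite invr_gt0; lra.
have eta_w i : 0 < w i -> eta <= w i / 2.
  move=> wi; rewrite -[leRHS]invrK lef_pV2 ?posrE ?invr_gt0 ?divr_gt0 //; last first.
    by lra.
  rewrite invf_div (bigD1 i) //= -addrA lerDl addr_ge0 //.
  by apply: sumr_ge0 => j _; rewrite divr_ge0.
have eta_m : eta * m%:R <= 1 / 2.
  rewrite mulrC ler_pdivrMr; last by lra.
  by lra.
have C0 : 0 <= C by apply: sumr_ge0 => i _; apply: sumr_ge0.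
apply/interior_norm; exists (eta / (C + 1)); first by rewrite divr_gt0 // ltr_wpDl.
move=> y yx; pose a := (y - x) *m M.
have aE : y - x = a *m D by rewrite mulmxKpV // submx_full.
pose b i := if 0 < w i then a 0 i else 0.
have a_le i : `|a 0 i| <= eta.
  have : `|a 0 i| <= C * `|y - x|.
    rewrite mxE; apply: (le_trans (ler_norm_sum _ _ _)).
    apply: (@le_trans _ _ ((\sum_k `|M k i|) * `|y - x|)).
      rewrite mulr_suml; apply: ler_sum => k _.
      by rewrite normrM mulrC ler_wpM2l // coord_le_norm.
    rewrite ler_wpM2r // /C [leRHS](bigD1 i) //= lerDl.
    by apply: sumr_ge0 => j _; apply: sumr_ge0.
  move=> /le_trans; apply; rewrite ltr_pdivlMr ?ltr_wpDl // in yx.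
  by apply: ltW; apply: le_lt_trans yx; rewrite mulrC ler_wpM2l // lerDl.
have b_le i : `|b i| <= eta by rewrite /b; case: ifP; rewrite ?normr0 // ltW.
have sb_le : `|\sum_i b i| <= 1 / 2.
  apply: (le_trans (ler_norm_sum _ _ _)); apply: le_trans eta_m.
  apply: (@le_trans _ _ (\sum_(i < m) eta)); first exact: ler_sum.
  by rewrite sumr_const card_ord mulr_natr.
have yE : y = x + \sum_i b i *: (v i - x).
  rewrite -[LHS](subrKC x) aE mulmx_sum_row; congr (_ + _).
  apply: eq_bigr => i _; rewrite rowK /b.
  by case: ifP => // _; rewrite scaler0 scale0r.
(* The factor [1 - \sum_i b i] restores total weight [1]. It is at least [1 / 2], so a positive
   weight keeps at least [eta] before [b i] is added. *)
exists (fun i => w i * (1 - \sum_i b i) + b i); split.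
- move=> i; rewrite /b; case: ifPn => [wi|wi].
    move: sb_le (a_le i) (eta_w i wi); rewrite !ler_norml.
    move=> /andP[sb1 sb2] /andP[a1 a2] ew.
    have : w i * (1 / 2) <= w i * (1 - \sum_i b i).
      by rewrite ler_wpM2l //; lra.
    by rewrite /b in sb1 sb2 *; lra.
  have -> : w i = 0 by apply/eqP; rewrite eq_le w0 andbT leNgt.
  by rewrite mul0r addr0.
- by rewrite big_split /= -mulr_suml w1 mul1r subrK.
- rewrite {1}yE.
  have -> : \sum_i b i *: (v i - x) = \sum_i b i *: v i - (\sum_i b i) *: x.
    rewrite scaler_suml -sumrB.
    by apply: eq_bigr => i _; rewrite scalerBr.
  transitivity ((1 - \sum_i b i) *: x + \sum_i b i *: v i).
    by rewrite scalerBl scale1r addrCA addrC addrAC.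
  rewrite /x scaler_sumr -big_split /=.
  by apply: eq_bigr => i _; rewrite scalerA scalerDl mulrC.
Qed.

(** The points carrying positive weight in a boundary point lie in one hyperplane, since otherwise
    [convex_hull_interior] applies. Indexing the planes by sets of points keeps them finite in
    number; those that carry no facet are sorted out later by [fat]. *)
Lemma convex_hull_boundary_cover : (0 < n)%N ->
  exists (U : {set 'I_m} -> 'rV[R]_n) (H : {set 'I_m} -> R),
    (forall I, U I != 0) /\
    (forall x, boundary (convex_hull_of v) x -> exists I, dot (U I) x = H I).
Proof.
move=> n0.
have planes (I : {set 'I_m}) : exists p : 'rV[R]_n * R, p.1 != 0 /\
    ((exists u h, u != 0 /\ forall i, i \in I -> dot u (v i) = h) ->
      forall i, i \in I -> dot p.1 (v i) = p.2).
  have [[u [h [u0 uh]]]|noplane] :=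
    pselect (exists u h, u != 0 /\ forall i, i \in I -> dot u (v i) = h).
    by exists (u, h).
  (* A default for sets [I] contained in no hyperplane: any nonzero form will do. *)
  exists (const_mx 1, 0); split=> //=.
  apply/negP => /eqP/rowP/(_ (Ordinal n0)); rewrite !mxE => /eqP.
  by rewrite oner_eq0.
have [p pP] := choice planes.
exists (fun I => (p I).1), (fun I => (p I).2); split=> [I|x [clx nix]].
  by case: (pP I).
have [w [w0 w1 xE]] : convex_hull_of v x.
  apply: compact_closed clx; [exact: norm_hausdorff | exact: convex_hull_compact].
pose I := [set i | 0 < w i]%SET; exists I.
have [_ pI] := pP I.
have {}pI i : i \in I -> dot (p I).1 (v i) = (p I).2.
  apply: pI; apply: contrapT => noplane; apply: nix; rewrite xE.
  apply: convex_hull_interior => // u u0; apply: contrapT => ui.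
  apply: noplane; exists u, (dot u x); split=> // j.
  rewrite inE => wj; apply: contrapT => /eqP uj; apply: ui.
  by exists j => //; rewrite -xE.
rewrite xE dot_sumr -[RHS]mul1r -w1 mulr_suml; apply: eq_bigr => i _.
rewrite dotZr; have [wi|wi] := boolP (0 < w i); first by rewrite pI ?inE.
suff -> : w i = 0 by rewrite !mul0r.
by apply/eqP; rewrite eq_le w0 andbT leNgt.
Qed.

End ConvexHull.

(** * Facet planes of a polytope *)

Lemma continuous_along (R : realType) (V : normedModType R) (f g : V -> R^o)
    (d : V -> V) (q : V) :
  continuous f -> continuous g -> continuous d -> g q != 0 ->
  {for q, continuous (fun y => y + (f y / g y) *: d y)}.
Proof.
move=> fc gc dc gq; apply: cvgD; first exact: cvg_id.
apply: cvgZ; last exact: dc.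
by apply: cvgM; [exact: fc | apply: cvgV; [exact: gq | exact: gc]].
Qed.

Section Facets.
Context {R : realType} {n : nat}.
Implicit Types (u x y q d : 'rV[R]_n) (h s t : R) (A K W : set 'rV[R]_n).

(** When [A] is the boundary of a polytope and [u] is nonzero, this expresses that the plane
    [dot u y = h] carries a facet, without any theory of faces. *)
Definition fat A u h : Prop :=
  exists c e, [/\ 0 < e, dot u c = h & flat_disc u c e `<=` A].

Lemma affine_continuous x s : continuous (fun q => x + s *: q : 'rV[R]_n).
Proof.
apply: (@lipschitz_continuous _ 'rV[R]_n 'rV[R]_n _ `|s|) => y z.
by rewrite opprD addrACA subrr add0r -scalerBr normrZ.
Qed.

Lemma affine_dot_continuous u a s :
  continuous (fun q => a + s * dot u q : R^o).
Proof.
apply: (@lipschitz_continuous _ 'rV[R]_n R^o _ (`|s| * \sum_i `|u 0 i|)).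
move=> y z.
rewrite opprD addrACA subrr add0r -mulrBr normrM -mulrA ler_wpM2l // -dotBr.
exact: dot_le_norm.
Qed.

Lemma boundary_closed K : closed (boundary K).
Proof.
rewrite /boundary setDE; apply: closedI; first exact: closed_closure.
by rewrite closedC; exact: open_interior.
Qed.

(** The point at the supremum of the times spent in [K] is a limit of points of [K]; were it
    interior, the ray would stay in [K] longer. *)
Lemma ray_meets_boundary K q d : bounded_set K -> K° q -> d != 0 ->
  exists2 t, 0 <= t & boundary K (q + t *: d).
Proof.
move=> [M [_ /(_ (M + 1))KM]] Kq d0.
have {KM}KM y : K y -> `|y| <= M + 1 by apply: KM; rewrite ltrDl.
have nd0 : 0 < `|d| by rewrite normr_gt0.
pose E := [set t | 0 <= t /\ K (q + t *: d)].
have E0 : E 0.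
  by split=> //; rewrite scale0r addr0; exact: interior_subset.
have ubE : has_sup E.
  split; first by exists 0.
  exists ((M + 1 + `|q|) / `|d|) => t [t0 /KM Kt].
  rewrite ler_pdivlMr // -[t]ger0_norm // -normrZ.
  have -> : t *: d = (q + t *: d) - q by rewrite addrC addKr.
  by apply: (le_trans (ler_normB _ _)); rewrite lerD2r.
have supE0 : 0 <= sup E by exact: ub_le_sup ubE.2 _ E0.
exists (sup E) => //; split.
  move=> A /nbhs_norm[e e0 eA].
  have [t [t0 Kt] tE] := sup_adherent (divr_gt0 e0 nd0) ubE.
  exists (q + t *: d); split => //; apply: eA.
  rewrite opprD addrACA subrr add0r -scalerBl normrZ -ltr_pdivlMr //.
  rewrite distrC ger0_norm; first by rewrite ltrBlDr -ltrBlDl.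
  by rewrite subr_ge0; exact: ub_le_sup ubE.2 _ (conj t0 Kt).
move=> /interior_norm[e e0 eK].
have h0 : 0 < e / 2 / `|d| by rewrite !divr_gt0.
have : E (sup E + e / 2 / `|d|).
  split; first by rewrite addr_ge0 // ltW.
  apply: eK; rewrite scalerDl opprD addrACA subrr add0r addrAC subrr add0r.
  rewrite normrZ gtr0_norm //.
  by rewrite divfK ?gt_eqF //; lra.
by move=> /(ub_le_sup ubE.2); lra.
Qed.

Lemma open_avoid_plane W u h : u != 0 -> open W -> W !=set0 ->
  exists W', [/\ open W', W' !=set0, W' `<=` W &
    forall q, W' q -> dot u q != h].
Proof.
move=> u0 Wo [q Wq]; exists (W `&` dot u @^-1` [set t | t != h]); split.
- apply: openI => //; apply: open_comp => [y _|]; first exact: dot_continuous.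
  exact: open_neq.
- have [uq|uq] := eqVneq (dot u q) h; last by exists q.
  have [w uw] := neq0_dot_eq1 _ u0.
  have /nbhs_norm[e e0 eO] : nbhs q W by apply: open_nbhs_nbhs; split.
  have w0 : 0 < `|w| + 1 by rewrite ltr_wpDl.
  exists (q + (e / (`|w| + 1)) *: w); split.
    apply: eO; rewrite addrAC subrr add0r normrZ gtr0_norm ?divr_gt0 //.
    by rewrite mulrAC ltr_pdivrMr // ltr_pM2l // ltrDl.
  rewrite /= dotDr dotZr uw uq mulr1 -subr_eq0 addrAC subrr add0r.
  by rewrite gt_eqF // divr_gt0.
- by move=> y [].
- by move=> y [].
Qed.

(* The lines [q + t (x + s q)] are those through the point [- x / s], or those
   parallel to [x] when [s = 0]; the condition on [x], [s] says that they do
   not lie in the plane [dot u y = h]. *)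
Lemma open_avoid_thin K u h x s W : closed K -> 0 <= s -> u != 0 ->
  dot u x + s * h != 0 -> ~ fat K u h -> open W -> W !=set0 ->
  exists W', [/\ open W', W' !=set0, W' `<=` W & forall q t, W' q -> 0 <= t ->
    K (q + t *: (x + s *: q)) -> dot u (q + t *: (x + s *: q)) != h].
Proof.
move=> Kcl s0 u0 xi nfat Wo Wn0.
pose den q := dot u x + s * dot u q.
have [W1 [W1o [q0 Wq0] W1O W1den]] : exists W1, [/\ open W1, W1 !=set0, W1 `<=` W &
    forall q, W1 q -> den q != 0].
  have [s00|sn0] := eqVneq s 0.
    exists W; split=> // q _; rewrite /den s00 mul0r addr0.
    by move: xi; rewrite s00 mul0r addr0.
  have [W1 [? ? ? W1h]] := open_avoid_plane _ _ (- dot u x / s) u0 Wo Wn0.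
  exists W1; split=> // q /W1h; apply: contra => /eqP dq.
  by apply/eqP; rewrite -[LHS](mulfK sn0); congr (_ / _); rewrite /den in dq; lra.
have hitE q t : dot u (q + t *: (x + s *: q)) = dot u q + t * den q.
  by rewrite dotDr dotZr dotDr dotZr.
(* The time at which the line from [q] crosses the plane. If it is negative somewhere, an open set
   of rays misses the plane; otherwise a crossing point is moved off [K]. *)
pose tau q := (h - dot u q) / den q.
have hit q t : den q != 0 -> dot u (q + t *: (x + s *: q)) = h -> t = tau q.
  by move=> dq E; rewrite /tau -E hitE; field.
have den_cont : continuous (den : _ -> R^o) by exact: affine_dot_continuous.
have num_cont : continuous (fun q => h - dot u q : R^o).
  have -> : (fun q => h - dot u q) = (fun q => h + -1 * dot u q).
    by apply/funext => q; rewrite mulN1r.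
  exact: affine_dot_continuous.
have [[q1 Wq1 tq1]|tau_ge0] := pselect (exists2 q, W1 q & tau q < 0).
  (* [g] has the sign of [tau] where [den] does not vanish, and it is continuous everywhere. *)
  pose g q := (h - dot u q) * den q.
  have g_cont : continuous (g : _ -> R^o).
    move=> q; exact: (@continuousM R 'rV[R]_n _ _ q (num_cont q) (den_cont q)).
  have sg q : den q != 0 -> (g q < 0) = (tau q < 0).
    move=> dq; have -> : g q = tau q * den q ^+ 2 by rewrite /g /tau; field.
    by rewrite pmulr_llt0 // exprn_even_gt0.
  exists (W1 `&` g @^-1` [set t | t < 0]); split.
  - apply: openI => //; apply: open_comp => [y _|]; first exact: g_cont.
    exact: open_lt.
  - by exists q1; split => //; rewrite /= sg // W1den.
  - by move=> q [/W1O].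
  - move=> q t [Wq /=]; rewrite sg ?W1den // => tq t0 _; apply/eqP => /hit tE.
    by move: tq; rewrite -tE ?W1den // ltNge t0.
pose t0 := tau q0.
have t00 : 0 <= t0 by rewrite leNgt; apply/negP => ?; apply: tau_ge0; exists q0.
pose p0 := q0 + t0 *: (x + s *: q0).
have up0 : dot u p0 = h.
  by rewrite hitE /t0 /tau; have := W1den _ Wq0 => ?; field.
have /nbhs_norm[e e0 eO] : nbhs q0 W1 by apply: open_nbhs_nbhs; split.
have [y [uy yp0] nKy] : exists2 y, flat_disc u p0 e y & ~ K y.
  apply: contrapT => yK; apply: nfat; exists p0, e; split=> // y yd.
  by apply: contrapT => nK; apply: yK; exists y.
have c1 : 1 <= 1 + t0 * s by rewrite lerDl mulr_ge0.
have c0 : 1 + t0 * s != 0 by rewrite gt_eqF // (lt_le_trans ltr01).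
(* The point whose line is at [y] at time [t0]. The factor is at most [1], so [q1] is as close to
   [q0] as [y] is to [p0]. *)
pose q1 := (1 + t0 * s)^-1 *: (y - t0 *: x).
have q1y : q1 + t0 *: (x + s *: q1) = y.
  rewrite scalerDr scalerA addrCA -[X in _ + (X + _)]scale1r -scalerDl /q1.
  by rewrite scalerA divff // scale1r addrC subrK.
have Wq1 : W1 q1.
  apply: eO; apply: le_lt_trans yp0.
  have -> : q1 - q0 = (1 + t0 * s)^-1 *: (y - p0).
    have -> : q0 = (1 + t0 * s)^-1 *: (p0 - t0 *: x).
      have -> : p0 - t0 *: x = (1 + t0 * s) *: q0.
        by apply/rowP => i; rewrite !mxE; ring.
      by rewrite scalerA mulVf // scale1r.
    by rewrite /q1 -scalerBr opprB addrA subrK.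
  rewrite normrZ normfV ger0_norm; last by apply: le_trans c1.
  by rewrite ler_piMl // invf_le1 // (lt_le_trans ltr01).
(* Projection onto the plane along the lines. It sends [q1] to [y], off the closed set [K], and by
   continuity sends all points near [q1] off [K]. *)
pose pi q := q + tau q *: (x + s *: q).
have piq1 : pi q1 = y by rewrite /pi -(hit q1 t0) // ?W1den // q1y uy up0.
have pi_cont : {for q1, continuous pi}.
  apply: (@continuous_along R 'rV[R]_n _ _ _ _ num_cont den_cont).
    exact: affine_continuous.
  exact: W1den.
have near_q1 : nbhs q1 (pi @^-1` (~` K)).
  apply: pi_cont; rewrite piq1.
  by apply: open_nbhs_nbhs; split=> //; exact: closed_openC.
exists (W1 `&` (pi @^-1` (~` K))°); split.
- by apply: openI => //; exact: open_interior.
- by exists q1.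
- by move=> q [/W1O].
- move=> q t [Wq /interior_subset nKq] _ Kt; apply/eqP => /hit tE.
  by apply: nKq; rewrite /pi -tE // W1den.
Qed.

(** Suppose that every facet plane passes through [- x / s], or is parallel to [x] when [s = 0].
    From a generic interior point [q], the ray of direction [x + s *: q] meets no plane of this
    kind, and it meets the other planes of the cover off the boundary or not at all. Yet it must
    cross the boundary. *)
Lemma fat_planes_span (T : finType) (U : T -> 'rV[R]_n) (H : T -> R) K x s :
  (0 < n)%N -> bounded_set K -> K° !=set0 -> (forall i, U i != 0) ->
  (forall y, boundary K y -> exists i, dot (U i) y = H i) ->
  0 <= s -> (x != 0) || (s != 0) ->
  exists2 i, fat (boundary K) (U i) (H i) & dot (U i) x + s * H i != 0.
Proof.
move=> n0 Kb K0 U0 cover s0 xs; apply: contrapT => nofat.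
(* Starting points whose direction [x + s *: q] does not vanish; the planes are then avoided one
   after the other by shrinking this open set. *)
have [W0 [W0o W00 W0K W0d]] : exists W, [/\ open W, W !=set0, W `<=` K° &
    forall q, W q -> x + s *: q != 0].
  have [s00|sn0] := eqVneq s 0.
    exists K°; split=> //; first exact: open_interior.
    by move=> q _; rewrite s00 scale0r addr0; move: xs; rewrite s00 eqxx orbF.
  pose k := Ordinal n0.
  have dk0 : delta_mx 0 k != 0 :> 'rV[R]_n.
    apply/eqP => /rowP/(_ k); rewrite !mxE !eqxx => /eqP.
    by rewrite oner_eq0.
  have [W [? ? ? Wk]] :=
    open_avoid_plane _ _ (- x 0 k / s) dk0 (@open_interior _ K) K0.
  exists W; split=> // q /Wk; apply: contra => /eqP xq.
  have -> : dot (delta_mx 0 k) q = q 0 k.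
    by rewrite -(dot_delta q k); apply: eq_bigr => j _; rewrite mulrC.
  have := congr1 (fun M : 'rV_n => M 0 k) xq; rewrite !mxE => xqk.
  by apply/eqP; rewrite -[LHS](mulfK sn0); congr (_ / _); lra.
have [W [_ [q Wq] WW0 Wmiss]] : exists W, [/\ open W, W !=set0, W `<=` W0 &
    forall q t i, i \in enum T -> W q -> 0 <= t ->
    boundary K (q + t *: (x + s *: q)) ->
    dot (U i) (q + t *: (x + s *: q)) != H i].
  elim: (enum T) => [|i r [W [Wo Wn0 WW0 IH]]].
    by exists W0; split=> // q t i; rewrite in_nil.
  have [W' [W'o W'0 W'W W'i]] : exists W', [/\ open W', W' !=set0, W' `<=` W &
      forall q t, W' q -> 0 <= t -> boundary K (q + t *: (x + s *: q)) ->
      dot (U i) (q + t *: (x + s *: q)) != H i].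
    have [xi|xi] := eqVneq (dot (U i) x + s * H i) 0; last first.
      apply: open_avoid_thin => //; first exact: boundary_closed.
      by move=> fi; apply: nofat; exists i.
    have [W' [? ? ? W'i]] := open_avoid_plane _ _ (H i) (U0 i) Wo Wn0.
    exists W'; split=> // q t /W'i qi t0 _; apply: contra qi => /eqP.
    (* Here the offset from [H i] at time [t] is [1 + t * s] times the offset at [q], so a ray
       starting off the plane never meets it. *)
    rewrite dotDr dotZr dotDr dotZr => E.
    have c0 : 1 + t * s != 0 by rewrite gt_eqF // ltr_wpDr // mulr_ge0.
    apply/eqP/(mulfI c0).
    rewrite (_ : dot (U i) x = - (s * H i)) in E; last by lra.
    by transitivity (H i + t * s * H i); [rewrite -{1}E; ring | ring].
  exists W'; split=> //; first exact: subset_trans WW0.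
  move=> q t j; rewrite inE => /orP[/eqP->|jr] Wq; first exact: W'i.
  by apply: IH => //; exact: W'W.
have Kq : K° q by apply: W0K; exact: WW0.
have [t t0 bt] := ray_meets_boundary _ _ _ Kb Kq (W0d _ (WW0 _ Wq)).
have [i /eqP] := cover _ bt.
by apply/negP; apply: Wmiss => //; rewrite mem_enum.
Qed.

(** By [fat_planes_span] no nonzero [(x, s)] is orthogonal to all vectors [(u, h)] of facet planes.
    Hence [n + 1] of these form an invertible matrix, and the entries of its inverse give [C]. *)
Lemma polytope_facets K : (0 < n)%N -> convex_polytope K ->
  exists (u : 'I_(n + 1) -> 'rV[R]_n) (h : 'I_(n + 1) -> R) (C : R),
  [/\ 0 < C, (forall i, u i != 0), (forall i, fat (boundary K) (u i) (h i)) &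
    forall x r b, (forall i, `|dot (u i) x + r * h i| <= b) -> `|x| <= C * b].
Proof.
move=> n0 [[m [v KE]] K0].
have Kb : bounded_set K by rewrite KE; exact/compact_bounded/convex_hull_compact.
have [U [H [U0]]] := convex_hull_boundary_cover v n0.
rewrite -KE => cover.
(* Planes without a facet become zero rows, which an invertible submatrix cannot contain. *)
pose f (k : 'I_#|{set 'I_m}|) : 'rV[R]_(n + 1) := let I := enum_val k in
  if `[< fat (boundary K) (U I) (H I) >] then row_mx (U I) (H I)%:M else 0.
pose A := \matrix_k f k.
have dot_row (z : 'rV[R]_(n + 1)) u h :
    dot z (row_mx u h%:M) = dot u (lsubmx z) + z 0 (rshift n 0) * h.
  rewrite /dot big_split_ord /= big_ord1; congr (_ + _).
    by apply: eq_bigr => i _; rewrite row_mxEl mxE mulrC.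
  by rewrite row_mxEr mxE mulr1n.
have Afull : row_full A.
  apply: contrapT => /negP/not_row_full_dot[z z0 zA].
  pose x := lsubmx z; pose s := z 0 (rshift n 0).
  have xs : (x != 0) || (s != 0).
    rewrite -negb_and; apply: contra z0 => /andP[/eqP x0 /eqP s0].
    apply/eqP/rowP => i; rewrite !mxE; case: (split_ordP i) => j ->.
      by have := congr1 (fun M : 'rV_n => M 0 j) x0; rewrite !mxE.
    by rewrite (ord1 j).
  have {}zA I : fat (boundary K) (U I) (H I) -> dot (U I) x + s * H I = 0.
    move=> fI; have := zA (enum_rank I).
    by rewrite rowK /f enum_rankK; case: asboolP => // _; rewrite dot_row.
  have [s0|s0] := leP 0 s.
    by have [I /zA->] := fat_planes_span _ _ _ _ _ _ n0 Kb K0 U0 cover s0 xs;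
      rewrite eqxx.
  (* [fat_planes_span] asks for a nonnegative [s], and orthogonality is unchanged under negation of
     [(x, s)]. *)
  have xs' : (- x != 0) || (- s != 0) by rewrite !oppr_eq0.
  have s0' : 0 <= - s by rewrite oppr_ge0 ltW.
  have [I /zA E] := fat_planes_span _ _ _ _ _ _ n0 Kb K0 U0 cover s0' xs'.
  by rewrite dotNr mulNr -opprD E oppr0 eqxx.
pose g := fullrankfun Afull; pose B := rowsub g A.
have Bunit : B^T \in unitmx by rewrite unitmx_tr; exact: fullrowsub_unit.
have Brow i : row i B = f (g i) by rewrite row_rowsub rowK.
pose I i := enum_val (g i).
have fatI i : fat (boundary K) (U (I i)) (H (I i)).
  apply: contrapT => nfat.
  have : row i B = 0 by rewrite Brow /f; case: asboolP.
  move=> B0; move: Bunit; rewrite unitmxE det_tr unitfE => /negP; apply.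
  apply/eqP.
  have -> : B = \matrix_i row i B by apply/row_matrixP => j; rewrite rowK.
  by rewrite (expand_det_row _ i) big1 // => j _; rewrite mxE B0 mxE mul0r.
pose C := \sum_i \sum_k `|invmx B^T i k| + 1.
have C0 : 0 <= \sum_i \sum_k `|invmx B^T i k|.
  by apply: sumr_ge0 => i _; apply: sumr_ge0.
exists (fun i => U (I i)), (fun i => H (I i)), C; split=> //.
  by rewrite ltr_wpDl.
move=> x r b tb; have b0 : 0 <= b.
  by apply: le_trans (tb (rshift n 0)); exact: normr_ge0.
pose z : 'rV[R]_(n + 1) := row_mx x r%:M.
have zE : z = (z *m B^T) *m invmx B^T by rewrite mulmxK.
have zB i : (z *m B^T) 0 i = dot (U (I i)) x + r * H (I i).
  rewrite mxE.
  transitivity (dot z (row i B)); first by apply: eq_bigr => j _; rewrite !mxE.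
  rewrite Brow /f; case: asboolP => [_|/(_ (fatI i))//].
  by rewrite dot_row row_mxKl row_mxEr mxE mulr1n.
apply: norm_le_coord; first by rewrite mulr_ge0 // addr_ge0.
move=> k; have -> : x 0 k = z 0 (lshift 1 k) by rewrite row_mxEl.
rewrite zE mxE; apply: (le_trans (ler_norm_sum _ _ _)).
apply: (@le_trans _ _ ((\sum_i \sum_k `|invmx B^T i k|) * b)); last first.
  by rewrite ler_wpM2r // lerDl.
rewrite mulr_suml; apply: ler_sum => i _; rewrite normrM mulrC zB.
apply: ler_pM => //.
by rewrite [leRHS](bigD1 (lshift 1 k)) //= lerDl sumr_ge0.
Qed.

End Facets.

(** * Separated families and covers by balls *)

(** A separated family of maximal size is a net: a point whose value is far from all the others
    could be added to it. *)
Lemma max_separated (R : realType) (X : Type) (A : set X) (t : X -> R) (l : R)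
    (q : nat) :
  let separated p (z : 'I_p -> X) := (forall a, A (z a)) /\
    (forall a b, a != b -> l < `|t (z a) - t (z b)|) in
  (forall p z, separated p z -> (p <= q)%N) ->
  exists p z, separated p z /\
    forall x, A x -> exists a, `|t x - t (z a)| <= l.
Proof.
move=> separated sepq.
pose Q p := `[< exists z, separated p z >].
have Q0 : exists p, Q p.
  exists 0%N; apply/asboolP; exists (fun a : 'I_0 => let: Ordinal _ h := a in
    False_rect X (notF h)).
  by split; case.
have Qq p : Q p -> (p <= q)%N by move=> /asboolP[z] /sepq.
case: (ex_maxnP Q0 Qq) => p /asboolP[z sz] maxp; exists p, z; split=> // x Ax.
apply: contrapT => /forallNP far.
suff : Q p.+1 by move=> /maxp; rewrite ltnn.
pose z' a := if unlift ord_max a is Some b then z b else x.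
apply/asboolP; exists z'; case: sz => [Az sepz]; split=> [a|a b].
  by rewrite /z'; case: unliftP.
have gt a' : l < `|t x - t (z a')| by rewrite ltNge; apply/negP/far.
rewrite /z'; case: unliftP => [a' ->|->]; case: unliftP => [b' ->|->].
- by move=> ab; apply: sepz; apply: contra ab => /eqP->.
- by rewrite distrC.
- by [].
- by rewrite eqxx.
Qed.

Section Covers.
Context {R : realType} {n : nat}.
Implicit Types (A : set 'rV[R]_n) (d : R) (c x : 'rV[R]_n).

Definition coverable A d k : Prop :=
  exists c : 'I_k -> 'rV[R]_n, A `<=` \bigcup_i euclidean_cball (c i) d.

Lemma euclidean_cball_norm c d x : euclidean_cball c d x -> `|x - c| <= d.
Proof.
move=> xd; apply: norm_le_coord; first by apply: le_trans xd; exact: sqrtr_ge0.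
move=> i; apply: le_trans xd; rewrite -sqrtr_sqr ler_sqrt; last first.
  by apply: sumr_ge0 => j _; exact: sqr_ge0.
rewrite !mxE [leRHS](bigD1 i) //= lerDl.
by apply: sumr_ge0 => j _; exact: sqr_ge0.
Qed.

Lemma norm_euclidean_cball c d x : n%:R * `|x - c| <= d -> euclidean_cball c d x.
Proof.
move=> xd; rewrite /euclidean_cball /=.
have d0 : 0 <= d by apply: le_trans xd; rewrite mulr_ge0.
rewrite -[leRHS](ger0_norm d0) -sqrtr_sqr ler_sqrt ?sqr_ge0 //.
apply: (@le_trans _ _ ((n%:R * `|x - c|) ^+ 2)); last first.
  by rewrite ler_pXn2r ?nnegrE // mulr_ge0.
apply: (@le_trans _ _ (\sum_(i < n) `|x - c| ^+ 2)).
  apply: ler_sum => i _; rewrite -[leLHS]ger0_norm ?sqr_ge0 // normrX.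
  rewrite ler_pXn2r ?nnegrE //.
  by have := coord_le_norm (x - c) i; rewrite !mxE.
rewrite sumr_const card_ord exprMn -[leLHS]mulr_natl ler_wpM2r ?sqr_ge0 //.
rewrite -natrX ler_nat; case: (n) => // k.
by rewrite expnS expn1 leq_pmulr.
Qed.

(** A finite union of closed balls is closed. This absorbs the closures that come from the Baire
    argument. *)
Lemma coverable_closure A d k : coverable A d k ->
  exists c : 'I_k -> 'rV[R]_n, forall x, closure A x ->
    exists i, `|x - c i| <= d.
Proof.
move=> [c Ac]; exists c => x Ax.
have cl : closed (\bigcup_(i in [set: 'I_k]) [set y | `|y - c i| <= d]).
  apply: closed_bigcup => [|i _]; first exact: finite_finset.
  exact: closed_norm_le.
have [|i _ xi] := cl x; last by exists i.
by apply: closure_subset Ax => y /Ac[i _ /euclidean_cball_norm yi]; exists i.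
Qed.

End Covers.

(** * Counting balls that meet parallel discs *)

Section Counting.
Context {R : realType} {n : nat}.
Implicit Types (u z y : 'rV[R]_n.+1).

(* A flat disc of fixed size contains about [d ^- n] points that are pairwise
   [d]-separated, and discs in planes at mutual distance much larger than [d]
   share no [d]-ball. *)
Lemma flat_discs_count u : u != 0 -> exists L kappa : R,
  [/\ 0 < L, 0 < kappa & forall (e d : R) (m N p : nat)
    (c : 'I_N -> 'rV[R]_n.+1) (z : 'I_p -> 'rV[R]_n.+1),
  0 < d -> m%:R * d * kappa < e ->
  (forall a y, flat_disc u (z a) e y -> exists i, `|y - c i| <= d) ->
  (forall a b, a != b -> L * d < `|dot u (z a) - dot u (z b)|) ->
  (p * m ^ n <= N)%N].
Proof.
move=> u0; have [k uk] : exists k, u 0 k != 0.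
  apply/existsP; rewrite -negb_forall; apply: contra u0 => /forallP u0.
  by apply/eqP/rowP => i; rewrite mxE; apply/eqP/u0.
(* Two points in a common [d]-ball are at distance at most [2 * d], so their values under [dot u]
   differ by at most [L * d]. *)
pose L := 2 * \sum_i `|u 0 i|.
pose kappa := 3 * (1 + (\sum_(j < n) `|u 0 (lift k j)|) / `|u 0 k|).
have q0 : 0 <= (\sum_(j < n) `|u 0 (lift k j)|) / `|u 0 k|.
  by rewrite divr_ge0 // sumr_ge0.
exists L, kappa; split.
- rewrite mulr_gt0 // (bigD1 k) //= ltr_pwDl ?normr_gt0 //.
  exact: sumr_ge0.
- by rewrite mulr_gt0 // ltr_pwDl.
move=> e d m N p c z d0 me discs sep.
(* An integer grid in the plane [dot u y = 0]: the coordinates other than [k] are free, and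
   coordinate [k] is solved for. *)
pose G (g : {ffun 'I_n -> 'I_m}) : 'rV[R]_n.+1 := \row_i
  (if unlift k i is Some j then (g j)%:R
   else - (\sum_(j < n) u 0 (lift k j) * (g j)%:R) / u 0 k).
have uG g : dot u (G g) = 0.
  rewrite /dot (bigD1_ord k) //= mxE unlift_none mulrC divfK //.
  under [X in _ + X]eq_bigr do rewrite mxE liftK.
  by rewrite addNr.
have Gle g : `|G g| <= m%:R * (kappa / 3).
  have k3 : kappa / 3 = 1 + (\sum_(j < n) `|u 0 (lift k j)|) / `|u 0 k|.
    by rewrite /kappa mulrC mulKf.
  have gm j : `|(g j)%:R| <= m%:R :> R by rewrite ger0_norm // ler_nat ltnW.
  apply: norm_le_coord; first by rewrite k3 mulr_ge0 // addr_ge0.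
  move=> i; rewrite mxE k3; case: unliftP => [j _|_].
    by apply: (le_trans (gm j)); rewrite ler_peMr // lerDl.
  apply: (@le_trans _ _ (m%:R * ((\sum_(j < n) `|u 0 (lift k j)|) / `|u 0 k|))).
    rewrite normrM normrN normfV mulrA ler_wpM2r ?invr_ge0 //.
    rewrite mulr_sumr; apply: (le_trans (ler_norm_sum _ _ _)).
    by apply: ler_sum => j _; rewrite normrM mulrC ler_wpM2r.
  by rewrite ler_wpM2l // lerDr.
(* Mesh [3 * d] exceeds the diameter [2 * d], so no ball contains two points of one grid. *)
pose y a g := z a + (3 * d) *: G g.
have uy a g : dot u (y a g) = dot u (z a).
  by rewrite dotDr dotZr uG mulr0 addr0.
have /choice[f fP] : forall ag : 'I_p * {ffun 'I_n -> 'I_m}, exists i,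
    `|y ag.1 ag.2 - c i| <= d.
  move=> [a g] /=.
  apply: (discs a); split; first exact: uy.
  rewrite /y addrC addKr normrZ ger0_norm ?mulr_ge0 // ?ltW //.
  apply: le_lt_trans me.
  apply: (@le_trans _ _ (3 * d * (m%:R * (kappa / 3)))).
    by rewrite ler_wpM2l // mulr_ge0 // ltW.
  by rewrite le_eqVlt; apply/orP; left; apply/eqP; field.
suff f_inj : injective f.
  by have := leq_card f f_inj; rewrite card_prod card_ffun !card_ord.
move=> [a g] [b g'] fE.
have yy : `|y a g - y b g'| <= 2 * d.
  have -> : y a g - y b g' = (y a g - c (f (a, g))) - (y b g' - c (f (b, g'))).
    by rewrite fE opprB addrA subrK.
  apply: (le_trans (ler_normB _ _)).
  by have := fP (a, g); have := fP (b, g'); rewrite /=; lra.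
have ab : a = b.
  apply: contrapT => /eqP/sep; rewrite -(uy a g) -(uy b g') -dotBr.
  apply/negP; rewrite -leNgt; apply: (le_trans (dot_le_norm _ _)).
  by rewrite /L [2 * _]mulrC -mulrA ler_wpM2l // sumr_ge0.
subst b; congr (_, _); apply/ffunP => j.
have := le_trans (coord_le_norm (y a g - y a g') (lift k j)) yy.
rewrite /y !mxE !liftK opprD addrACA subrr add0r -mulrBr normrM.
rewrite (ger0_norm (_ : 0 <= 3 * d)); last by lra.
move=> gg3; have gg : 3 * `|(g j)%:R - (g' j)%:R| <= 2 :> R.
  by rewrite -(ler_pM2r d0); lra.
apply/val_inj/eqP; rewrite /= -(eqr_nat R) -subr_eq0 -normr_le0.
apply: contraT; rewrite -ltNge normr_gt0 subr_eq0 => gne.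
suff : 1 <= `|(g j)%:R - (g' j)%:R| :> R by lra.
move: gne; rewrite eqr_nat neq_ltn => /orP[gl|gl].
  rewrite distrC ger0_norm ?subr_ge0 ?ler_nat 1?ltnW //.
  by rewrite lerBrDr nat1r ler_nat.
rewrite ger0_norm ?subr_ge0 ?ler_nat 1?ltnW //.
by rewrite lerBrDr nat1r ler_nat.
Qed.

(** For each [i], a maximal separated family of facet offsets has some [p] members with
    [p * m ^ n <= N i]. Centers are classified by a nearby member for every [i]; by the Lipschitz
    hypothesis each class fits in one ball, and the number of classes is the product of the [p]. *)
Lemma centers_coverable (u : 'I_(n.+1 + 1) -> 'rV[R]_n.+1) h (C e : R)
    (F : 'I_(n.+1 + 1) -> set 'rV[R]_n.+1) (S : set 'rV[R]_n.+1) :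
  0 < C -> (forall i, u i != 0) ->
  (forall x r b, (forall i, `|dot (u i) x + r * h i| <= b) -> `|x| <= C * b) ->
  (forall x, S x -> exists r, forall i, exists c,
    dot (u i) c = dot (u i) x + r * h i /\
    flat_disc (u i) c e `<=` closure (F i)) ->
  exists C1 kappa : R, [/\ 0 < C1, 0 < kappa &
    forall (d : R) (m : nat) (N : 'I_(n.+1 + 1) -> nat),
    0 < d -> (0 < m)%N -> m%:R * d * kappa < e ->
    (forall i, coverable (F i) d (N i)) ->
    exists2 k, coverable S (C1 * d) k &
      (k * (m ^ n) ^ (n.+1 + 1) <= \prod_i N i)%N].
Proof.
move=> C0 u0 uC SF.
have /choice[l /choice[k LkP]] := fun i => flat_discs_count _ (u0 i).
pose L := \sum_i l i; pose kappa := \sum_i k i.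
have Li i : l i <= L.
  rewrite /L (bigD1 i) //= lerDl sumr_ge0 // => j _.
  by have [/ltW] := LkP j.
have ki i : k i <= kappa.
  rewrite /kappa (bigD1 i) //= lerDl sumr_ge0 // => j _.
  by have [_ /ltW] := LkP j.
pose i0 : 'I_(n.+1 + 1) := rshift n.+1 0.
have L0 : 0 < L by apply: lt_le_trans (Li i0); have [] := LkP i0.
have k0 : 0 < kappa by apply: lt_le_trans (ki i0); have [] := LkP i0.
(* Offsets within a class differ by at most [2 * L * d]; [C] turns this into a max norm bound and
   [n.+1] into a Euclidean one. *)
exists (n.+1%:R * (C * (2 * L))), kappa; split=> //.
  by rewrite !mulr_gt0.
move=> d m N d0 m0 me NF.
have /choice[rc rcP] : forall x, exists rc : R * ('I_(n.+1 + 1) -> 'rV[R]_n.+1),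
    S x -> forall i, dot (u i) (rc.2 i) = dot (u i) x + rc.1 * h i /\
      flat_disc (u i) (rc.2 i) e `<=` closure (F i).
  move=> x; have [Sx|nSx] := pselect (S x); last by exists (0, fun=> 0).
  by have [r /choice[c cP]] := SF x Sx; exists (r, c).
pose t i x := dot (u i) ((rc x).2 i).
have /choice[pz pzP] : forall i, exists pz : {p : nat & 'I_p -> 'rV[R]_n.+1},
    (tag pz * m ^ n <= N i)%N /\
    forall x, S x -> exists a, `|t i x - t i (tagged pz a)| <= L * d.
  move=> i; have [c cF] := coverable_closure _ _ _ (NF i).
  have count p (z : 'I_p -> 'rV[R]_n.+1) :
      (forall a, S (z a)) /\
      (forall a b, a != b -> L * d < `|t i (z a) - t i (z b)|) ->
      (p * m ^ n <= N i)%N.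
    move=> [Sz sepz]; have [_ _ cnt] := LkP i.
    apply: (cnt e d m (N i) p c (fun a => (rc (z a)).2 i)) => //.
    - by apply: le_lt_trans me; rewrite ler_wpM2l // mulr_ge0 // ltW.
    - by move=> a y yd; apply: cF; have [_] := rcP _ (Sz a) i; apply.
    - by move=> a b /sepz; apply: le_lt_trans; rewrite ler_wpM2r // ltW.
  have [p z sz|p [z [sz cov]]] :=
    @max_separated R _ S (t i) (L * d) (N i).
    by apply: leq_trans (count p z sz); rewrite leq_pmulr // expn_gt0 m0.
  by exists (Tagged _ z); split => //; exact: count sz.
pose T := {dffun forall i, 'I_(tag (pz i))}.
pose cls (f : T) x := S x /\
  forall i, `|t i x - t i (tagged (pz i) (f i))| <= L * d.
(* Each nonempty class is covered by a ball around one of its members. *)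
have /choice[cen cenP] : forall f, exists y, (exists x, cls f x) -> cls f y.
  move=> f; have [[x fx]|nx] := pselect (exists x, cls f x).
    by exists x.
  by exists 0.
exists #|T|.
  exists (fun a => cen (enum_val a)) => x Sx.
  have cl_x i : exists a, `|t i x - t i (tagged (pz i) a)| <= L * d.
    by have [_] := pzP i; apply.
  pose f : T := [ffun i => sval (cid (cl_x i))].
  have fx : cls f x by split=> // i; rewrite ffunE; case: cid.
  exists (enum_rank f) => //; rewrite enum_rankK.
  have [Sc fc] := cenP f (ex_intro _ x fx).
  apply: norm_euclidean_cball; rewrite -mulrA ler_wpM2l // -mulrA.
  (* The offsets are linear in center and ratio together, so the Lipschitz bound applies to
     differences. *)
  apply: (uC _ ((rc x).1 - (rc (cen f)).1)) => i.
  have -> : dot (u i) (x - cen f) + ((rc x).1 - (rc (cen f)).1) * h i =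
      t i x - t i (cen f).
    rewrite /t (rcP _ Sx i).1 (rcP _ Sc i).1 dotBr; ring.
  have := fx.2 i; have := fc i; rewrite !ler_norml => /andP[? ?] /andP[? ?].
  by apply/andP; split; lra.
rewrite card_dep_ffun foldrE big_image /=.
under eq_bigr do rewrite card_ord.
rewrite -[X in ((m ^ n) ^ X)%N]card_ord -prod_nat_const -big_split /=.
by apply: leq_prod => i _; have [] := pzP i.
Qed.

End Counting.

(** * Upper box dimension through eventual covering bounds *)

Section BoxDimension.
Context {R : realType} {n : nat}.
Implicit Types (A : set 'rV[R]_n) (d s : R).

Lemma covering_number_ge0 A d : (0 <= covering_number A d)%E.
Proof. by apply/ereal_infP => _ [k _ <-]; rewrite lee_fin. Qed.

Lemma ln_inv_gt0 d : 0 < d -> d < 1 -> 0 < ln d^-1.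
Proof. by move=> d0 d1; rewrite ln_gt0 // invf_gt1. Qed.

Lemma upper_box_dim_lt A s : (upper_box_dim A < s%:E)%E ->
  exists2 r, 0 < r & forall d, 0 < d -> d < r ->
    exists2 k, coverable A d k & k%:R <= expR (s * ln d^-1).
Proof.
move=> /ereal_inf_lt[_ [V [r /= r0 rV] <-] supV].
(* Below [1] the denominator [ln d^-1] is positive and can be cleared; [expR (s * ln d^-1)] is the
   power [d^-s]. *)
exists (Num.min r 1); first by rewrite lt_min r0 ltr01.
move=> d d0; rewrite lt_min => /andP[dr d1].
have L0 := ln_inv_gt0 _ d0 d1.
have Vd : V d by apply: rV => //=; rewrite sub0r normrN gtr0_norm.
have /(le_lt_trans (ereal_sup_ubound (imageP _ Vd))) := supV.
rewrite inver gt_eqF // lte_pdivrMr // -EFinM => Nd.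
have {}Nd : (covering_number A d < (expR (s * ln d^-1))%:E)%E.
  have e0 := expR_gt0 (s * ln d^-1).
  rewrite -lte_lne; first by rewrite lne_EFin // expRK.
  - by rewrite in_itv /= covering_number_ge0 leey.
  - by rewrite in_itv /= lee_fin expR_ge0 leey.
have [_ [k Ak <-]] := ereal_inf_lt Nd; rewrite lte_fin => /ltW ks.
by exists k.
Qed.

Lemma upper_box_dim_le A s r : 0 < r -> (forall d, 0 < d -> d < r ->
    exists2 k, coverable A d k & k%:R <= expR (s * ln d^-1)) ->
  (upper_box_dim A <= s%:E)%E.
Proof.
move=> r0 Ak; pose V := [set d : R | 0 < d /\ d < Num.min r 1].
have V0 : 0^'+ V.
  exists (Num.min r 1) => /=; first by rewrite lt_min r0 ltr01.
  by move=> d /=; rewrite sub0r normrN => dr d0; split=> //; rewrite -(gtr0_norm d0).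
apply: (@le_trans _ _ (ereal_sup
    [set (lne (covering_number A d) / (ln d^-1)%:E)%E | d in V])).
  by apply: ereal_inf_lbound; exists V.
apply/ereal_supP => _ [d [d0 dr1] <-].
have /andP[dr d1] : (d < r) && (d < 1) by rewrite -lt_min.
have L0 := ln_inv_gt0 _ d0 d1.
rewrite inver gt_eqF // lee_pdivrMr // -EFinM.
have [k kc ks] := Ak d d0 dr.
rewrite -[X in (_ <= X%:E)%E]expRK -lne_EFin ?expR_gt0 //.
rewrite lee_lne; last 2 first.
- by rewrite in_itv /= covering_number_ge0 leey.
- by rewrite in_itv /= lee_fin expR_ge0 leey.
apply: (@le_trans _ _ k%:R%:E); last by rewrite lee_fin.
by apply: ereal_inf_lbound; exists k.
Qed.

End BoxDimension.

(** * Dimension of a set of centers with uniform discs *)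

Section CentersDimension.
Context {R : realType} {n : nat}.

(** With each [N i] at most [d^-s] and [m] of order [d^-1], the count of [centers_coverable] becomes
    a constant times [d^-((n + 2) * (s - n))]; an arbitrarily small [eps] absorbs the constant. *)
Lemma centers_upper_box_dim (u : 'I_(n.+1 + 1) -> 'rV[R]_n.+1) h (C e s : R)
    (F : 'I_(n.+1 + 1) -> set 'rV[R]_n.+1) (S : set 'rV[R]_n.+1) :
  0 < C -> 0 < e -> (forall i, u i != 0) ->
  (forall x r b, (forall i, `|dot (u i) x + r * h i| <= b) -> `|x| <= C * b) ->
  (forall x, S x -> exists r, forall i, exists c,
    dot (u i) c = dot (u i) x + r * h i /\
    flat_disc (u i) c e `<=` closure (F i)) ->
  (forall i, upper_box_dim (F i) < s%:E)%E ->
  (upper_box_dim S <= (n.+2%:R * (s - n%:R))%:E)%E.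
Proof.
move=> C0 e0 u0 uC SF Fs.
have [C1 [kappa [C10 k0 cov]]] := centers_coverable _ _ _ _ _ _ C0 u0 uC SF.
have /choice[rho rhoP] : forall i, exists r, 0 < r /\ forall d, 0 < d -> d < r ->
    exists2 k, coverable (F i) d k & k%:R <= expR (s * ln d^-1).
  by move=> i; have [r] := upper_box_dim_lt _ _ (Fs i); exists r.
have [r0 r00 r0P] : exists2 r0, 0 < r0 & forall i, r0 <= rho i.
  have inv0 i : 0 <= (rho i)^-1 by rewrite invr_ge0; have [/ltW] := rhoP i.
  exists (\sum_i (rho i)^-1 + 1)^-1.
    by rewrite invr_gt0 ltr_wpDl // sumr_ge0.
  move=> i; have [ri _] := rhoP i; rewrite -[leRHS]invrK lef_pV2 ?posrE ?invr_gt0 //.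
    by rewrite (bigD1 i) //= -addrA lerDl addr_ge0 // sumr_ge0.
  by rewrite ltr_wpDl // sumr_ge0.
apply/lee_addgt0Pr => eps eps0; rewrite -EFinD.
set sig := n.+2%:R * (s - n%:R).
pose c2 := e / (4 * kappa).
have c20 : 0 < c2 by rewrite divr_gt0 // mulr_gt0.
pose c3 := (c2 ^+ n) ^- n.+2 * expR (sig * ln C1).
have c30 : 0 < c3.
  by rewrite mulr_gt0 ?expR_gt0 // invr_gt0 !exprn_gt0.
(* The first bound gives [d < r0] and [d < c2] for [d = d' / C1]; the second gives
   [c3 <= d'^-eps]. *)
pose r1 := Num.min (C1 * Num.min r0 c2) (expR (- (ln c3 / eps))).
apply: (@upper_box_dim_le _ _ _ _ r1).
  by rewrite lt_min expR_gt0 mulr_gt0 // lt_min r00.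
move=> d' d'0; rewrite lt_min => /andP[d'r d'c].
pose d := d' / C1.
have d0 : 0 < d by rewrite divr_gt0.
have d'E : d' = C1 * d by rewrite mulrC divfK // gt_eqF.
have /andP[dr dc] : (d < r0) && (d < c2).
  by rewrite -lt_min -(ltr_pM2l C10) -d'E.
(* Since [c2 / d > 1], truncation leaves [m] between [c2 / d] and [2 * c2 / d]; the upper bound
   makes [m * d * kappa] at most [e / 2]. *)
pose m := Num.trunc (2 * c2 / d).
have mle : m%:R <= 2 * c2 / d by rewrite truncn_le ltW // divr_gt0 // mulr_gt0.
have mgt : 2 * c2 / d < m%:R + 1 by rewrite natr1 truncnS_gt.
have c2d : 1 < c2 / d by rewrite ltr_pdivlMr // mul1r.
have mge : c2 / d <= m%:R by rewrite -mulrA in mgt; lra.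
have m0 : (0 < m)%N by rewrite -(ltr_nat R); lra.
have mke : m%:R * d * kappa < e.
  apply: (@le_lt_trans _ _ (2 * c2 / d * d * kappa)).
    by rewrite !ler_wpM2r // ltW.
  rewrite divfK ?gt_eqF // /c2.
  rewrite (_ : 2 * (e / (4 * kappa)) * kappa = e / 2); last by field; rewrite gt_eqF.
  by lra.
have /choice[N NP] : forall i, exists k, coverable (F i) d k /\
    k%:R <= expR (s * ln d^-1).
  move=> i; have [_ /(_ d d0)] := rhoP i.
  by case=> [|k]; [exact: lt_le_trans (r0P i) | exists k].
have [i|k kS kN] := cov d m N d0 m0 mke; first by have [] := NP i.
exists k; first by rewrite d'E.
have kN' : k%:R * (m%:R ^+ n) ^+ n.+2 <= expR (s * ln d^-1) ^+ n.+2.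
  apply: (@le_trans _ _ (\prod_i (N i)%:R)).
    by rewrite -natr_prod -!natrX -natrM ler_nat -[n.+2]addn1.
  rewrite -[X in _ ^+ X]addn1 -[X in _ ^+ X]card_ord -prodr_const.
  by apply: ler_prod => i _; rewrite ler0n /=; have [] := NP i.
have kle : k%:R <= expR (s * ln d^-1) ^+ n.+2 / ((c2 / d) ^+ n) ^+ n.+2.
  rewrite ler_pdivlMr; last by rewrite !exprn_gt0 // divr_gt0.
  apply: le_trans kN'; rewrite ler_wpM2l // !lerXn2r // ?nnegrE ?exprn_ge0 //.
  - by rewrite divr_ge0 // ltW.
  - by rewrite divr_ge0 // ltW.
apply: (le_trans kle).
have lnd : ln d^-1 = ln d'^-1 + ln C1.
  by rewrite /d invf_div lnM ?posrE ?invr_gt0 // addrC.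
have dE : d^-1 = expR (ln d^-1) by rewrite lnK // posrE invr_gt0.
have -> : expR (s * ln d^-1) ^+ n.+2 / ((c2 / d) ^+ n) ^+ n.+2 =
    c3 * expR (sig * ln d'^-1).
  clearbody d c2; rewrite !exprMn invfM.
  have -> : ((d^-1 ^+ n) ^+ n.+2)^-1 = expR (- (n.+2%:R * (n%:R * ln d^-1))).
    by rewrite {1}dE -!expRM_natl expRN.
  rewrite -expRM_natl mulrCA -expRD /c3 -mulrA -expRD.
  by congr (_ * expR _); rewrite lnd /sig; ring.
rewrite mulrDl expRD mulrC ler_pM2l ?expR_gt0 //.
rewrite -[leLHS]lnK ?posrE // ler_expR.
rewrite mulrC -ler_pdivrMr // lnV ?posrE //.
rewrite lerNr -ler_expR lnK ?posrE //.
exact: ltW.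
Qed.

End CentersDimension.

(** * Packing dimension by a countable decomposition of the centers *)

Theorem mainTheorem17 (R : realType) (n : nat) (n_gt0 : (0 < n)%N)
    (K P S B : set 'rV[R]_n)
    (polyK : convex_polytope K) (PE : P = boundary K)
    (BS : forall x, S x -> exists r : R, 0 < r /\ homothetic_copy x r P `<=` B) :
  (packing_dim B >= (n%:R - 1)%:E + (1 / (n%:R + 1))%:E * packing_dim S)%E.
Proof.
case: n n_gt0 K P S B polyK PE BS => // n _ K P S B polyK PE BS.
have [u [h [C [C0 u0 fatu uC]]]] := polytope_facets K (ltn0Sn n) polyK.
apply/ereal_infP => _ [F [Fb BF] <-].
set sigma := ereal_sup _.
(* Comparison with real [s] above [sigma] also settles the infinite values of [sigma]. *)
suff main s : (sigma < s%:E)%E ->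
    ((n.+1%:R - 1)%:E + (1 / (n.+1%:R + 1))%:E * packing_dim S <= s%:E)%E.
  case: (sigma) main => [r| |] main; last 2 first.
  - exact: leey.
  - rewrite leeNy_eq; apply/eqP/eq_ninfty => A; apply: main; exact: ltNyr.
  - apply/lee_addgt0Pr => e e0; rewrite -EFinD; apply: main.
    by rewrite lte_fin ltrDl.
move=> sigs.
suff dimS : (packing_dim S <= (n.+2%:R * (s - n%:R))%:E)%E.
  apply: (@le_trans _ _ ((n.+1%:R - 1)%:E +
      (1 / (n.+1%:R + 1))%:E * (n.+2%:R * (s - n%:R))%:E)%E).
    by rewrite leeD2l // lee_wpmul2l // lee_fin divr_ge0 // addr_ge0.
  rewrite -EFinM -EFinD lee_fin natr1 mul1r mulKf ?pnatr_eq0 //.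
  by rewrite -natr1; lra.
(* [p.1] records which set of the cover serves each facet; the integer [p.2] bounds both the center
   and the inverse radius of the discs, so that there are countably many bounded pieces. *)
pose piece (p : {ffun 'I_(n.+1 + 1) -> nat} * nat) : set 'rV[R]_n.+1 :=
  [set x | `|x| <= p.2%:R /\ exists r, forall i, exists c,
    dot (u i) c = dot (u i) x + r * h i /\
    flat_disc (u i) c p.2.+1%:R^-1 `<=` closure (F (p.1 i))].
pose G l := if unpickle l is Some p then piece p else set0.
apply: (@le_trans _ _ (ereal_sup (range (fun l => upper_box_dim (G l))))).
  apply: ereal_inf_lbound; exists G => //; split.
    move=> l; rewrite /G; case: unpickle => [p|]; last first.
      by exists 0; split=> // M _ x [].
    exists p.2%:R; split; first exact: num_real.
    by move=> M pM x [xp _]; apply: le_trans xp (ltW pM).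
  move=> x Sx; have [r [r0 rB]] := BS x Sx.
  have /choice[J JP] : forall i, exists j, exists ce : 'rV[R]_n.+1 * R,
      [/\ 0 < ce.2, dot (u i) ce.1 = dot (u i) x + r * h i &
        flat_disc (u i) ce.1 ce.2 `<=` closure (F j)].
    move=> i; have [c [e [e0 uc ceP]]] := fatu i.
    have uxc : dot (u i) (x + r *: c) = dot (u i) x + r * h i.
      by rewrite dotDr dotZr uc.
    have [y [uy yc]|j [c' [e' [e'0 uc' c'F]]]] :=
      @flat_disc_baire R n.+1 (u i) (x + r *: c) (r * e) F (u0 i) (mulr_gt0 r0 e0).
      apply: BF; apply: rB; exists (r^-1 *: (y - x)); last first.
        by rewrite scalerA divff ?gt_eqF // scale1r addrC subrK.
      rewrite PE; apply: ceP; split.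
        by rewrite dotZr dotBr uy uxc uc addrC addKr mulKf // gt_eqF.
      have -> : r^-1 *: (y - x) - c = r^-1 *: (y - (x + r *: c)).
        by apply/rowP => k; rewrite !mxE; field; rewrite gt_eqF.
      by rewrite normrZ gtr0_norm ?invr_gt0 // mulrC ltr_pdivrMr // mulrC.
    by exists j, (c', e'); split=> //=; rewrite uc'.
  have [ce ceP] := choice JP.
  (* The sum dominates [x] and every inverse radius at once; [b.+1] exceeds it strictly. *)
  pose b := Num.trunc (`|x| + \sum_i (ce i).2^-1).
  have inv0 i : 0 <= (ce i).2^-1 by rewrite invr_ge0 ltW //; have [] := ceP i.
  have s0 : 0 <= \sum_i (ce i).2^-1 by exact: sumr_ge0.
  have bgt : `|x| + \sum_i (ce i).2^-1 < b.+1%:R by rewrite truncnS_gt.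
  exists (pickle ([ffun i => J i], b.+1)) => //; rewrite /G pickleK; split=> /=.
    by apply: ltW; apply: le_lt_trans bgt; rewrite lerDl.
  exists r => i; have [e0 uc cF] := ceP i; exists (ce i).1; split=> // y [uy yc].
  rewrite ffunE; apply: cF; split=> //; apply: (lt_le_trans yc).
  rewrite -[leRHS]invrK lef_pV2 ?posrE ?invr_gt0 //.
  apply: (@le_trans _ _ b.+1%:R); last by rewrite ler_nat.
  apply: ltW; apply: le_lt_trans bgt.
  by rewrite (bigD1 i) //= addrCA lerDl addr_ge0 // sumr_ge0.
apply/ereal_supP => _ [l _ <-]; rewrite /G; case: unpickle => [p|]; last first.
  apply: (@upper_box_dim_le _ _ _ _ 1) => // d _ _; exists 0%N.
    by exists (fun=> 0) => x [].
  exact: expR_ge0.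
apply: (@centers_upper_box_dim _ _ u h C p.2.+1%:R^-1 s (fun i => F (p.1 i))) => //.
- by move=> x [_ pS].
- move=> i; apply: le_lt_trans sigs; apply: ereal_sup_ubound.
  by exists (p.1 i).
Qed.
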